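(* Let $X$ be a finite set of candidates, let $P_X$ be an $n$-voter profile on $X$, let $x^*\in X$, and let $k\ge 1$ be an integer. Then $x^*$ is a possible cowinner for $P_X$ and plurality with respect to the addition of $k$ new candidates if and only if $$ntop(P_X,x^* ) \;\geq\; \frac{1}{k}\cdot\sum_{x_i\in X}\max\bigl(0,\; ntop(P_X,x_i)-ntop(P_X,x^* )\bigr).$$
   Context: A vote over a finite candidate set $C$ is a linear order on $C$; an $n$-voter $C$-profile ($n\ge 1$) is a list $\langle V_1,\dots,V_n\rangle$ of votes over $C$. $ntop(P,x)$ is the number of votes in $P$ ranking $x$ first. The plurality correspondence $r$ maps a profile $P$ over $C$ to the set of candidates $x\in C$ maximizing $ntop(P,x)$; elements of $r(P)$ are called cowinners. If $X\subseteq C$, a $C$-profile $P'=\langle V_1',\dots,V_n'\rangle$ extends an $X$-profile $P_X=\langle V_1,\dots,V_n\rangle$ if for each $i$ the restriction of $V_i'$ to $X$ is $V_i$. A candidate $x^*\in X$ is a possible cowinner for $P_X$ and $r$ with respect to the addition of $k$ new candidates if there is an $(X\cup Y)$-profile $P'$ extending $P_X$ with $x^*\in r(P')$, where $Y=\{y_1,\dots,y_k\}$ is a set of $k$ candidates disjoint from $X$. *)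

(* Defs.v *)
From HB Require Import structures.
From mathcomp Require Import all_boot all_order all_algebra.
From mathcomp Require Import finmap.

Set Implicit Arguments.
Unset Strict Implicit.
Unset Printing Implicit Defensive.

Import Order.TTheory GRing.Theory Num.Theory.

Local Open Scope fset_scope.

(* [V a b] means that [a] is ranked at least as high as [b]. *)
Record vote (T : choiceType) (C : {fset T}) := Vote {
  vote_rel :> rel C;
  vote_linear : [/\ reflexive vote_rel, antisymmetric vote_rel,
                    transitive vote_rel & total vote_rel] }.

Definition profile (T : choiceType) (n : nat) (C : {fset T}) :=
  n.-tuple (vote C).

Definition ranks_first (T : choiceType) (C : {fset T}) (V : vote C) (x : C) :
    bool :=
  [forall y : C, V x y].

Definition ntop (T : choiceType) (n : nat) (C : {fset T}) (P : profile n C)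
    (x : C) : nat :=
  #|[set i : 'I_n | ranks_first (tnth P i) x]|.

Definition plurality (T : choiceType) (n : nat) (C : {fset T})
    (P : profile n C) : {set C} :=
  [set x : C | [forall y : C, ntop P y <= ntop P x]].

Definition extends (T : choiceType) (n : nat) (X C : {fset T})
    (sXC : X `<=` C) (P' : profile n C) (P : profile n X) : Prop :=
  forall (i : 'I_n) (a b : X),
    tnth P' i (fincl sXC a) (fincl sXC b) = tnth P i a b.

(* [Y] is the set of new candidates; its disjointness from [X] and its
   cardinality are hypotheses wherever this predicate is used. *)
Definition possible_cowinner (T : choiceType) (n : nat) (X Y : {fset T})
    (P : profile n X) (x : X) : Prop :=
  exists P' : profile n (X `|` Y),
    extends (fsubsetUl X Y) P' P /\ fincl (fsubsetUl X Y) x \in plurality P'.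

(* Main.v *)
(* If [x] cowins after the addition, every candidate [xi] must lose at least
   [ntop P xi - ntop P x] first places to the new candidates, each of which may
   in turn hold at most [ntop P x] of them. Conversely, keep at most
   [ntop P x] first places for every old candidate, spread the surplus voters
   over the new candidates with at most [ntop P x] voters each, and promote the
   chosen new candidate to the top of each surplus vote. *)
Require Import Defs.
From HB Require Import structures.
From mathcomp Require Import all_boot all_order all_algebra.
From mathcomp Require Import finmap.

Set Implicit Arguments.
Unset Strict Implicit.
Unset Printing Implicit Defensive.

Import Order.TTheory GRing.Theory Num.Theory.

Local Open Scope fset_scope.

Lemma card_partition_fun (I J : finType) (t : I -> J) (A : {set I}) :
  #|A| = \sum_j #|[set i in A | t i == j]|.
Proof.
rewrite -sum1_card (partition_big t xpredT) //=.
by apply: eq_bigr => j _; rewrite -sum1_card; apply: eq_bigl => i; rewrite inE.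
Qed.

Lemma card_isSome (I J : finType) (u : I -> option J) :
  #|[set i | isSome (u i)]| = \sum_j #|[set i | u i == Some j]|.
Proof.
(* Split by the value of [u]; the fibre over [None] is empty, and the others are reindexed along
   [Some]. *)
rewrite (card_partition_fun u) (bigD1 None) //=.
have -> : [set i in [set i | isSome (u i)] | u i == None] = set0.
  by apply/setP => i; rewrite !inE; case: (u i).
rewrite cards0 add0n.
rewrite (reindex_omap Some id) => [|[]//].
apply: eq_big => [j|j _]; first by rewrite /= eqxx.
by apply: eq_card => i; rewrite !inE; case: (u i).
Qed.

(** Each element of [A] goes to the element of [J] at the same position in the enumeration. The
    [option] keeps [f] total even when [J] is empty. *)
Lemma partial_injection (I J : finType) (A : {set I}) : #|A| <= #|J| ->
  exists2 f : I -> option J, forall i, isSome (f i) = (i \in A)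
    & {in A &, injective f}.
Proof.
move=> leAJ.
have ltJ i : i \in A -> index i (enum A) < #|J|.
  by move=> iA; apply: leq_trans leAJ; rewrite cardE index_mem mem_enum.
exists (fun i => if i \in A =P true is ReflectT iA
                 then Some (enum_val (Ordinal (ltJ i iA))) else None).
  by move=> i; case: eqP => //= /negP/negPf ->.
move=> i j iA jA; case: eqP => // iA'; case: eqP => // jA' [] /enum_val_inj [].
by move/(congr1 (nth i (enum A))); rewrite !nth_index ?mem_enum.
Qed.

(** Read [t i] as the favourite of voter [i], and [u i] as the newcomer who takes over that first
    place, [None] meaning no change. Each newcomer offers [m] slots, so the surplus voters inject
    into [K * 'I_m]. The last clause protects groups within the quota. *)
Lemma spread_surplus (I J K : finType) (t : I -> J) (m : nat) :
    \sum_j (#|[set i | t i == j]| - m) <= #|K| * m ->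
  exists u : I -> option K,
    [/\ forall j, #|[set i | (t i == j) && (u i == None)]| <= m,
        forall c, #|[set i | u i == Some c]| <= m
      & forall j, #|[set i | t i == j]| <= m -> forall i, t i = j -> u i = None].
Proof.
move=> le_m; pose G j := [set i | t i == j].
(* The surplus voters: all but the first [m] of each group. *)
pose R := [set i | i \notin take m (enum (G (t i)))].
have leR : #|R| <= #|{: K * 'I_m}|.
  rewrite card_prod card_ord; apply: leq_trans le_m.
  rewrite (card_partition_fun t); apply: leq_sum => j _.
  rewrite [in leqRHS]cardE -size_drop; apply: leq_trans (card_size _).
  apply/subset_leq_card/subsetP => i; rewrite !inE => /andP[iR /eqP tij].
  have: i \in take m (enum (G j)) ++ drop m (enum (G j)).
    by rewrite cat_take_drop mem_enum inE tij.
  by rewrite mem_cat; move: iR; rewrite tij => /negPf ->.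
have [f fR f_inj] := partial_injection leR.
have fN i : (omap fst (f i) == None) = (i \notin R) by rewrite -fR; case: (f i).
exists (fun i => omap fst (f i)); split=> [j|c|j lejm i tij].
- apply: (@leq_trans (size (take m (enum (G j))))); last first.
    by rewrite size_take_min geq_minl.
  apply: leq_trans (card_size _); apply/subset_leq_card/subsetP=> i.
  by rewrite inE fN !inE negbK => /andP[/eqP <-].
(* Voters sent to [c] occupy distinct slots [(c, o)], of which there are [m]. *)
- rewrite -[leqRHS]card_ord -[leqRHS]cardsT.
  apply: leq_trans (leq_imset_card (fun o : 'I_m => Some (c, o)) _).
  rewrite -(card_in_imset (f := f)); last first.
    move=> i j; rewrite !inE => /eqP fi /eqP fj.
    by apply: f_inj; rewrite -fR; [case: (f i) fi|case: (f j) fj].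
  apply/subset_leq_card/subsetP=> _ /imsetP[i + ->]; rewrite inE.
  case: (f i) => // -[c' o] /= /eqP[->]; apply/imsetP; by exists o.
- apply/eqP; rewrite fN inE negbK take_oversize ?mem_enum ?inE //.
  by rewrite -cardE tij.
Qed.

Section Votes.
Variables (T : choiceType).
Implicit Types C X Y : {fset T}.

Lemma vote_anti C (V : vote C) a b : V a b -> V b a -> a = b.
Proof. by case: (vote_linear V) => _ anti _ _ ab ba; apply: anti; rewrite ab. Qed.

Lemma ranks_first_uniq C (V : vote C) a b :
  ranks_first V a -> ranks_first V b -> a = b.
Proof. by move=> /forallP aV /forallP bV; apply: (vote_anti (V := V)). Qed.

Lemma exists_ranks_first C (V : vote C) : C -> exists a, ranks_first V a.
Proof.
case: (vote_linear V) => Vr _ Vt Vtot x.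
have [a _ aP] := @extremumP _ _ V x predT id Vr Vt Vtot isT.
by exists a; apply/forallP => b; apply: aP.
Qed.

Lemma exists_top n C (P : profile n C) : C ->
  exists t : 'I_n -> C, forall i, ranks_first (tnth P i) (t i).
Proof.
move=> x; have ex i := exists_ranks_first (tnth P i) x.
by exists (fun i => xchoose (ex i)) => i; apply: xchooseP.
Qed.

Lemma ntopE n C (P : profile n C) (t : 'I_n -> C) :
    (forall i, ranks_first (tnth P i) (t i)) ->
  forall c, ntop P c = #|[set i | t i == c]|.
Proof.
move=> tP c; apply: eq_card => i; rewrite !inE.
apply/idP/eqP => [cP|<- //]; exact: ranks_first_uniq (tP i) cP.
Qed.

Definition promote_rel C (V : vote C) (z : C) : rel C :=
  fun a b => (a == z) || (b != z) && V a b.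

Lemma promote_linear C (V : vote C) z :
  [/\ reflexive (promote_rel V z), antisymmetric (promote_rel V z),
      transitive (promote_rel V z) & total (promote_rel V z)].
Proof.
case: (vote_linear V) => Vr Va Vt Vtot; rewrite /promote_rel; split.
- by move=> a; rewrite Vr andbT orbN.
- move=> a b; case: eqP => [->|_]; case: eqP => [->|_] //=; exact: Va.
- move=> b a c; case: (a == z); case: (b == z); case: (c == z) => //=.
  exact: Vt.
- by move=> a b; case: (a == z); case: (b == z) => /=.
Qed.

Definition promote C (V : vote C) (z : C) : vote C :=
  Vote (promote_linear V z).

Lemma ranks_first_promote C (V : vote C) z : ranks_first (promote V z) z.
Proof. by apply/forallP => a; rewrite /= /promote_rel eqxx. Qed.

(** [insub] decides membership in [X], so [C] need not contain [X] here; [enum_rank] is just some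
    linear order on the candidates outside [X]. *)
Definition append_rel X C (V : vote X) : rel C := fun a b =>
  match insub (val a) : option X, insub (val b) : option X with
  | Some a', Some b' => V a' b'
  | Some _, None => true
  | None, Some _ => false
  | None, None => enum_rank a <= enum_rank b
  end.

Lemma append_linear X C (V : vote X) :
  [/\ reflexive (append_rel (C := C) V), antisymmetric (append_rel (C := C) V),
      transitive (append_rel (C := C) V) & total (append_rel (C := C) V)].
Proof.
case: (vote_linear V) => Vr Va Vt Vtot; rewrite /append_rel; split.
- by move=> a; case: insubP.
- move=> a b; case: insubP => [a' _ ea|_]; case: insubP => [b' _ eb|_] //.
    by move=> /Va eab; apply: val_inj; rewrite /= -ea -eb eab.
  by move=> /anti_leq/val_inj/enum_rank_inj.
- move=> b a c; case: insub => [b'|]; case: insub => [a'|];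
    case: insub => [c'|] //; [exact: Vt | exact: leq_trans].
- by move=> a b; case: insub => [a'|]; case: insub => [b'|] //; exact: leq_total.
Qed.

Definition append X C (V : vote X) : vote C := Vote (append_linear C V).

Lemma append_fincl X C (sXC : X `<=` C) (V : vote X) a b :
  append C V (fincl sXC a) (fincl sXC b) = V a b.
Proof. by rewrite /= /append_rel /= !valK. Qed.

Lemma fincl_inj X C (sXC : X `<=` C) : injective (fincl sXC).
Proof. by move=> a b /(congr1 val) /= /val_inj. Qed.

(** Promoting the old favourite changes nothing among old candidates. This lets every vote of the
    constructed profile be a promotion, with or without a change of favourite. *)
Lemma promote_fincl X C (sXC : X `<=` C) (V : vote X) t a b :
    ranks_first V t ->
  promote (append C V) (fincl sXC t) (fincl sXC a) (fincl sXC b) = V a b.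
Proof.
move=> /forallP tV; rewrite [LHS]/= /promote_rel append_fincl.
rewrite !(inj_eq (@fincl_inj _ _ sXC)).
case: eqP => [->|nat_]; first by rewrite tV.
case: eqP => [->|//] /=; apply/esym/negP => aV.
by apply: nat_; apply: vote_anti aV (tV a).
Qed.

Lemma promote_new X C (sXC : X `<=` C) (V : vote X) z a b :
    val z \notin X ->
  promote (append C V) z (fincl sXC a) (fincl sXC b) = V a b.
Proof.
move=> zX; rewrite [LHS]/= /promote_rel append_fincl.
have neq c : (fincl sXC c == z) = false.
  by apply: contraNF zX => /eqP <-; exact: (valP c).
by rewrite !neq.
Qed.

Lemma ranks_first_restrict X C (sXC : X `<=` C) (V' : vote C) (V : vote X) a :
    (forall a b, V' (fincl sXC a) (fincl sXC b) = V a b) ->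
  ranks_first V' (fincl sXC a) -> ranks_first V a.
Proof. by move=> ext /forallP aV; apply/forallP => b; rewrite -ext. Qed.

Lemma surplus_of_cowinner n X Y (P : profile n X) x : possible_cowinner Y P x ->
  \sum_xi (ntop P xi - ntop P x) <= #|` Y| * ntop P x.
Proof.
case=> P' [ext]; rewrite inE => /forallP xwin.
set sX := fsubsetUl X Y in ext xwin; pose sY := fsubsetUr X Y.
have [t tP] := exists_top P x; have [t' tP'] := exists_top P' (fincl sX x).
(* An old candidate on top of an extended vote was already on top of the original one. *)
have restr i a : t' i = fincl sX a -> t i = a.
  move=> e; apply: ranks_first_uniq (tP i) _.
  by apply: (ranks_first_restrict (V' := tnth P' i) (ext i)); rewrite -e.
have le_x : ntop P' (fincl sX x) <= ntop P x.
  rewrite (ntopE tP') (ntopE tP); apply/subset_leq_card/subsetP => i.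
  by rewrite !inE => /eqP/restr ->.
pose u i : option Y := insub (val (t' i)).
(* The intermediate quantity is the number of first places held by new candidates. *)
apply: (@leq_trans #|[set i | isSome (u i)]|).
  rewrite (card_partition_fun t); apply: leq_sum => a _.
  rewrite leq_subLR.
  apply: leq_trans (leq_add (leq_trans (xwin (fincl sX a)) le_x) (leqnn _)).
  (* Each original supporter of [a] either still ranks [a] first or now ranks a new candidate
     first. *)
  rewrite (ntopE tP) (ntopE tP'); apply: leq_trans (leq_card_setU _ _).
  apply/subset_leq_card/subsetP => i; rewrite !inE => ti; rewrite ti andbT /u.
  have [iY|iNY] := boolP (val (t' i) \in Y); first by rewrite insubT orbT.
  have iX : val (t' i) \in X.
    by have := valP (t' i); rewrite in_fsetU (negPf iNY) orbF.
  have e : t' i = fincl sX [` iX] by apply: val_inj.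
  by rewrite {1}e -(restr _ _ e) (eqP ti) eqxx.
rewrite card_isSome cardfE -sum_nat_const; apply: leq_sum => y _.
apply: leq_trans (leq_trans (xwin (fincl sY y)) le_x).
rewrite (ntopE tP'); apply/subset_leq_card/subsetP => i; rewrite !inE /u.
by case: insubP => // y' _ e /eqP[<-]; apply/eqP/val_inj; rewrite -e.
Qed.

Lemma cowinner_of_surplus n X Y (P : profile n X) x : [disjoint X & Y] ->
    \sum_xi (ntop P xi - ntop P x) <= #|` Y| * ntop P x ->
  possible_cowinner Y P x.
Proof.
move=> dXY; have [t tP] := exists_top P x.
set m := ntop P x; pose sX := fsubsetUl X Y; pose sY := fsubsetUr X Y.
have newX (y : Y) : val y \notin X.
  by apply: contraTN (valP y); apply/fdisjointP.
rewrite cardfE; under eq_bigr do rewrite (ntopE tP).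
case/spread_surplus => u [u_old u_new u_x].
(* The intended top of vote [i]: its assigned newcomer, or else its old favourite. *)
pose z i := if u i is Some y then fincl sY y else fincl sX (t i).
pose P' : profile n (X `|` Y) :=
  [tuple promote (append (X `|` Y) (tnth P i)) (z i) | i < n].
have zP' i : ranks_first (tnth P' i) (z i).
  by rewrite tnth_mktuple ranks_first_promote.
exists P'; split.
  move=> i a b; rewrite tnth_mktuple /z.
  by case: (u i) => [y|]; [apply/promote_new/newX | apply: promote_fincl].
(* The value [m] separates the counts: [x] keeps all its [m] supporters, since its group is within
   the quota, and no candidate exceeds [m]. *)
rewrite inE; apply/forallP => c; apply: (@leq_trans m); last first.
  rewrite (ntopE zP') /m (ntopE tP); apply/subset_leq_card/subsetP => i.
  rewrite !inE /z => /eqP ti; rewrite (u_x x _ i ti) ?ti //.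
  by rewrite /m (ntopE tP).
rewrite (ntopE zP').
have /fsetUP[cX|cY] := valP c.
  apply: leq_trans (u_old [` cX]); apply/subset_leq_card/subsetP => i.
  rewrite !inE /z; case: (u i) => [y|] /eqP e.
    by have := newX y; rewrite -[val y]/(val (fincl sY y)) e cX.
  by rewrite eqxx andbT; apply/eqP/val_inj; rewrite /= -e.
apply: leq_trans (u_new [` cY]); apply/subset_leq_card/subsetP => i.
rewrite !inE /z; case: (u i) => [y|] /eqP e.
  by apply/eqP; congr Some; apply: val_inj; rewrite /= -e.
(* An unassigned vote has an old candidate on top, which by disjointness cannot be the new candidate
   [c]. *)
have : val c \in X by rewrite -e; exact: (valP (t i)).
by move/fdisjointP: dXY => /[apply]; rewrite cY.
Qed.

End Votes.

Local Open Scope ring_scope.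

(** Truncated subtraction already computes the maximum with 0, so the rational criterion reduces to
    an inequality between natural numbers. *)
Lemma max0_natrB (R : realDomainType) (a b : nat) :
  Num.max 0 (a%:R - b%:R) = (a - b)%N%:R :> R.
Proof.
case: (leqP b a) => [le_ba|/ltnW le_ab].
  by rewrite natrB //; apply: max_r; rewrite subr_ge0 ler_nat.
move: (le_ab); rewrite -subn_eq0 => /eqP ->.
by apply: max_l; rewrite subr_le0 ler_nat.
Qed.

Theorem proposition1 (T : choiceType) (X Y : {fset T}) (n k : nat)
    (hn : (1 <= n)%N) (hk : (1 <= k)%N)
    (hXY : [disjoint X & Y]) (hY : #|` Y| = k)
    (P : profile n X) (x : X) :
  possible_cowinner Y P x <->
  (ntop P x)%:R >=
    1 / k%:R * \sum_(xi : X) Num.max 0 ((ntop P xi)%:R - (ntop P x)%:R) :> rat.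
Proof.
under eq_bigr do rewrite max0_natrB.
rewrite -natr_sum mulrAC mul1r ler_pdivrMr ?ltr0n // -natrM ler_nat mulnC -hY.
by split; [apply: surplus_of_cowinner | apply: cowinner_of_surplus].
Qed.
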